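(* For every even integer $a\ge 2$, there is an upcycle for $\{0,\ldots,a-1\}^8$.
   Context: Let $A$ be an alphabet with $a=|A|\ge 2$ letters and $\diamond\notin A$ a wildcard symbol (''diamond''). A partial word is a finite sequence over $A\cup\{\diamond\}$; a cyclic partial word $u=(u_1\cdots u_N)$ is cyclically ordered, with indices taken modulo $N$. A partial word $x$ covers a word $y$ of the same length if for each $i$ either $x_i=\diamond$ or $x_i=y_i$. For $n\ge 1$, the window of $u$ at position $i\in\{1,\dots,N\}$ is $u_i\cdots u_{i+n-1}$. An upcycle (universal partial cycle) for $A^n$ is a cyclic partial word $u=(u_1\cdots u_N)$ such that each word of $A^n$ is covered by the window at exactly one position $i\in\{1,\dots,N\}$. *)

(* Defs.v *)
From mathcomp Require Import all_boot.

Set Implicit Arguments.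
Unset Strict Implicit.
Unset Printing Implicit Defensive.

(* A letter [c] is [Some c]; the diamond is [None]. *)
Definition partial_word (A : Type) := seq (option A).

(* Positions are numbered from 0 and read modulo the length of [u]; the window
   may wrap around several times when [size u < n]. *)
Definition window (A : Type) (n : nat) (u : partial_word A) (i : nat) :
    partial_word A :=
  mkseq (fun j => nth None u ((i + j) %% size u)) n.

Definition covers (A : eqType) (x : partial_word A) (y : seq A) : bool :=
  all2 (fun c d => (c == None) || (c == Some d)) x y.

Definition is_upcycle (A : eqType) (n : nat) (u : partial_word A) : Prop :=
  forall w : n.-tuple A,
    exists! i : 'I_(size u), covers (window n u i) w.

(* Excludes the two degenerate kinds of upcycle: De Bruijn cycles, which
   contain no diamond, and all-diamond words such as the one of length 1. *)
Definition nontrivial (A : eqType) (u : partial_word A) : Prop :=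
  None \in u /\ exists c : A, Some c \in u.

(* Main.v *)
(* Write a = 2 b. Let u be a binary upcycle for words of length 8 whose diamonds
   sit exactly at the multiples of 8; its length is N = 2^7. Repeat u b^7 times
   and attach to the letter at position i = p + N k (p < N) the base-b digit of
   weight b^(7 - (i mod 8)) of the lap number k. A word over pairs determines p
   by its binary part. The window at p + N k meets each of the seven digit
   positions once; it reads the digits of k, except that after crossing into the
   next lap it reads the high digits of k + 1. Knowing the low digits of k and
   the high digits of k + 1 still determines k mod b^7, so each base-b part
   occurs for exactly one k. *)

Require Import Defs.
From mathcomp Require Import all_boot zify.

Set Implicit Arguments.
Unset Strict Implicit.
Unset Printing Implicit Defensive.

Lemma all2_map2 (I S T : Type) (r : S -> T -> bool) (f : I -> S) (g : I -> T) s :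
  all2 r (map f s) (map g s) = all (fun i => r (f i) (g i)) s.
Proof. by elim: s => //= i s ->. Qed.

Lemma covers_windowE (A : eqType) n (u : partial_word A) i (w : n.-tuple A) :
  covers (window n u i) w =
  [forall j : 'I_n, let c := nth None u ((i + j) %% size u) in
                    (c == None) || (c == Some (tnth w j))].
Proof.
rewrite /covers -[X in all2 _ _ X]map_tnth_enum /window /mkseq -val_enum_ord -map_comp.
rewrite all2_map2 /=; apply/allP/forallP => [P j | P j _]; last exact: P.
by apply: P; rewrite mem_enum.
Qed.

(** Positions become plain numbers, so that they can be written as [p + N * k] and split by
    division. *)
Lemma is_upcycleP (A : eqType) n (u : partial_word A) :
  is_upcycle n u <-> forall w : n.-tuple A,
    exists! i, i < size u /\ covers (window n u i) w.
Proof.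
split=> up w; have [i] := up w.
  case=> cov uniq; exists i; split=> // k [lt_k cov_k].
  by rewrite (uniq (Ordinal lt_k) cov_k).
case=> -[lt_i cov] uniq; exists (Ordinal lt_i); split=> // k cov_k.
by apply: val_inj; apply: uniq; split; first exact: ltn_ord.
Qed.

Lemma is_upcycle_map (A B : eqType) (f : A -> B) n (u : partial_word A) :
  bijective f -> is_upcycle n u -> is_upcycle n (map (omap f) u).
Proof.
case=> g fK gK /is_upcycleP up; apply/is_upcycleP => w; rewrite size_map.
have covE i : i < size u -> covers (window n (map (omap f) u) i) w =
                            covers (window n u i) (map_tuple g w).
  move=> lt_i; rewrite !covers_windowE size_map; apply: eq_forallb => j.
  rewrite /= tnth_map (nth_map None) ?ltn_pmod //; last by apply: leq_ltn_trans lt_i.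
  case: nth => //= x.
  by rewrite -[tnth w j in LHS]gK !(inj_eq Some_inj) (can_eq fK).
have [i [[lt_i cov] uniq]] := up (map_tuple g w).
exists i; split=> [|k [lt_k]]; first by rewrite covE.
by rewrite covE // => cov_k; apply: uniq.
Qed.

(** The base written b in the overview is [b.+1] here, which makes it positive by form. *)
Definition digit b e k : 'I_b.+1 := Ordinal (ltn_pmod (k %/ b.+1 ^ e) (ltn0Sn b)).

Lemma digitE b e k : digit b e k = k %% b.+1 ^ e.+1 %/ b.+1 ^ e :> nat.
Proof. by rewrite /= modn_divl -expnS. Qed.

Lemma digit_mod b m e k : e < m -> digit b e (k %% b.+1 ^ m) = digit b e k.
Proof. by move=> lt_em; apply: ord_inj; rewrite !digitE modn_dvdm // dvdn_exp2l. Qed.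

Lemma digits_inj b t m k k' : t <= m -> k = k' %[mod b.+1 ^ t] ->
  (forall e, t <= e < m -> digit b e k = digit b e k') -> k = k' %[mod b.+1 ^ m].
Proof.
move=> le_tm eq_t; elim: m le_tm => [|m IHm]; first by case: t eq_t.
rewrite leq_eqVlt ltnS => /predU1P[<- // | le_tm] eq_dig.
have split_mod l : l %% b.+1 ^ m.+1 = digit b m l * b.+1 ^ m + l %% b.+1 ^ m.
  by rewrite {1}(divn_eq (l %% _) (b.+1 ^ m)) -digitE modn_dvdm // dvdn_exp2l.
rewrite !split_mod IHm // => [|e /andP[le_te lt_em]].
  by rewrite eq_dig // le_tm /=.
by rewrite eq_dig // le_te ltnW.
Qed.

(* [t] is the weight from which the digits are read off [k + 1] instead of [k];
   there is no carry when [m <= t]. *)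
Lemma digits_carry_bij b m t :
  bijective (fun k : 'I_(b.+1 ^ m) => [ffun e : 'I_m => digit b e (k + (t <= e))]).
Proof.
apply: inj_card_bij; last by rewrite card_ffun !card_ord.
move=> k k' /ffunP eq_kk'.
have eq_dig e : e < m -> digit b e (k + (t <= e)) = digit b e (k' + (t <= e)).
  by move=> lt_em; have := eq_kk' (Ordinal lt_em); rewrite !ffunE.
have eq_low : k = k' %[mod b.+1 ^ minn t m].
  apply: (@digits_inj _ 0) => [//||e]; first by rewrite !modn1.
  rewrite leq_min => /and3P[_ lt_et lt_em].
  by have := eq_dig e lt_em; rewrite leqNgt lt_et !addn0.
(* The residues modulo [b.+1 ^ minn t m] agree, hence also those of the successors, whose higher
   digits are the ones given. *)
have : k + 1 = k' + 1 %[mod b.+1 ^ m].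
  apply: (@digits_inj _ (minn t m)) => [||e]; first exact: geq_minr.
    by apply/eqP; rewrite eqn_modDr; apply/eqP.
  rewrite geq_min => /andP[/orP[le_te | le_me] lt_em]; last by lia.
  by have := eq_dig e lt_em; rewrite le_te.
by move/eqP; rewrite eqn_modDr !modn_small // => /eqP/val_inj.
Qed.

Definition upcycle_product (A : Type) b m (u : partial_word A) :
    partial_word (A * 'I_b.+1)%type :=
  mkseq (fun i => omap (fun x => (x, digit b (m - i %% m.+1) (i %/ size u)))
                       (nth None u (i %% size u)))
        (size u * b.+1 ^ m).

(** Indices past the last lap wrap to lap 0: digits of weight below [m] see the lap number only
    modulo [b.+1 ^ m], and weight [m] arises only at diamonds. *)
Lemma nth_upcycle_product (A : Type) b m (u : partial_word A) i :
  0 < size u -> m.+1 %| size u ->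
  (m.+1 %| i -> nth None u (i %% size u) = None) ->
  nth None (upcycle_product b m u) (i %% (size u * b.+1 ^ m)) =
  omap (fun x => (x, digit b (m - i %% m.+1) (i %/ size u))) (nth None u (i %% size u)).
Proof.
move=> u_gt0 dvd_mu diamond_i.
rewrite nth_mkseq ?ltn_pmod ?muln_gt0 ?u_gt0 ?expn_gt0 //.
rewrite !modn_dvdm ?dvdn_mulr //; case Di: nth => [x|] //=; congr (Some (x, _)).
rewrite [size u * _]mulnC -modn_divl digit_mod //.
have : ~~ (m.+1 %| i) by apply/negP => /diamond_i; rewrite Di.
by rewrite /dvdn; lia.
Qed.

(* A window starting at [p] has crossed into the next lap at offset [j] exactly
   when the digit there has weight at least [N - p]. *)
Lemma divn_carry m N p j : 0 < N -> m.+1 %| N -> p < N -> j < m.+1 ->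
  (p + j) %/ N = (N - p <= m - (p + j) %% m.+1).
Proof.
move=> N_gt0 /dvdnP[c defN] lt_pN lt_jm.
have def_pj := divn_eq (p + j) m.+1.
have lt_r : (p + j) %% m.+1 < m.+1 by rewrite ltn_pmod.
move: (_ %/ m.+1) (_ %% m.+1) def_pj lt_r => q r def_pj lt_r.
have le_mN : m.+1 <= N by rewrite defN leq_pmull //; case: c defN N_gt0 => // ->.
have [le_Npj | lt_pjN] := leqP N (p + j).
  have -> : (p + j) %/ N = 1.
    by rewrite -(subnKC le_Npj) -[X in X + _]mul1n divnMDl // divn_small; lia.
  (* As [N] consists of [c] blocks of length [m.+1] and [j < m.+1], the index [p + j] lies in block
     [c], the first of the next lap. *)
  have le_cq : c <= q by rewrite -ltnS -(ltn_pmul2r (ltn0Sn m)) mulSn -defN; lia.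
  have le_qc : q <= c by rewrite -ltnS -(ltn_pmul2r (ltn0Sn m)) mulSn -defN; lia.
  have eq_qc : q = c by apply/eqP; rewrite eqn_leq le_qc.
  by move: def_pj; rewrite eq_qc -defN => def_pj; apply/esym/eqP; rewrite eqb1; lia.
rewrite divn_small //.
(* Before the crossing, the whole block containing [p + j] still fits below [N]. *)
have : q.+1 * m.+1 <= N.
  by rewrite defN leq_pmul2r // -(ltn_pmul2r (ltn0Sn m)) -defN; lia.
by rewrite mulSn => le_qN; apply/esym/eqP; rewrite eqb0; lia.
Qed.

Lemma is_upcycle_product (A : eqType) b m (u : partial_word A) :
  m.+1 %| size u ->
  (forall i, i < size u -> (nth None u i == None) = (m.+1 %| i)) ->
  is_upcycle m.+1 u -> is_upcycle m.+1 (upcycle_product b m u).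
Proof.
move=> dvd_mu diamondE /is_upcycleP up; apply/is_upcycleP => w.
rewrite size_mkseq; set N := size u.
(* The offset, in the window at [p], of the digit of weight [e]. *)
pose pos p e : 'I_m.+1 := inord ((m - e + (m.+1 - p %% m.+1)) %% m.+1).
have pos_mod p e : (p + pos p e) %% m.+1 = m - e.
  rewrite inordK ?ltn_pmod // modnDmr -modnDml.
  have -> : p %% m.+1 + (m - e + (m.+1 - p %% m.+1)) = m - e + m.+1.
    by have := ltn_pmod p (ltn0Sn m); lia.
  by rewrite modnDr modn_small //; lia.
have posK p (j : 'I_m.+1) : pos p (m - (p + j) %% m.+1) = j.
  apply: ord_inj; rewrite inordK ?ltn_pmod // subKn -1?ltnS ?ltn_pmod //.
  rewrite modnDml -addnA -modnDml.
  have -> : p %% m.+1 + (j + (m.+1 - p %% m.+1)) = j + m.+1.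
    by have := ltn_pmod p (ltn0Sn m); lia.
  by rewrite modnDr modn_small.
(* Covering splits: [p] alone decides the first components and, given [p], the digits of [k] decide
   the second ones. *)
have covE p k : p < N ->
    covers (window m.+1 (upcycle_product b m u) (p + N * k)) w =
    covers (window m.+1 u p) (map_tuple fst w) &&
    ([ffun e : 'I_m => digit b e (k + (N - p <= e))] ==
     [ffun e : 'I_m => (tnth w (pos p e)).2]).
  move=> lt_pN; have N_gt0 : 0 < N by apply: leq_ltn_trans lt_pN.
  have diamondP i : (nth None u (i %% N) == None) = (m.+1 %| i).
    by rewrite diamondE ?ltn_pmod // /dvdn modn_dvdm.
  have nth_prod (j : 'I_m.+1) :
      nth None (upcycle_product b m u) ((p + N * k + j) %% (N * b.+1 ^ m)) =
      let e := m - (p + j) %% m.+1 in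
      omap (fun x => (x, digit b e (k + (N - p <= e)))) (nth None u ((p + j) %% N)).
    have -> : p + N * k + j = k * N + (p + j) by lia.
    rewrite nth_upcycle_product // => [|dvd_i]; last by apply/eqP; rewrite diamondP.
    rewrite modnMDl divnMDl // (divn_carry N_gt0 dvd_mu) //.
    by rewrite -modnDml -modnMmr (eqP dvd_mu) muln0 mod0n.
  rewrite !covers_windowE size_mkseq -/N.
  apply/forallP/andP => [P | [/forallP Pu /eqP/ffunP Pdig] j].
    split.
      apply/forallP => j; have /= := P j; rewrite nth_prod tnth_map.
      by case: nth => //= x; rewrite !(inj_eq Some_inj) => /eqP <- /=.
    apply/eqP/ffunP => e; rewrite !ffunE.
    have /= := P (pos p e); rewrite nth_prod pos_mod (subKn (ltnW (ltn_ord e))) /=.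
    (* As [e < m], the index [p + pos p e] is no multiple of [m.+1], so a letter stands there. *)
    have := diamondP (p + pos p e); rewrite /dvdn pos_mod subn_eq0 leqNgt ltn_ord.
    by case: nth => //= x _; rewrite (inj_eq Some_inj) => /eqP <-.
  have /= := Pu j; rewrite nth_prod tnth_map /=.
  have := diamondP (p + j); case: nth => //= x /esym/negbT ndvd_pj.
  rewrite !(inj_eq Some_inj) => /eqP ->.
  have lt_em : m - (p + j) %% m.+1 < m by move: ndvd_pj; rewrite /dvdn; lia.
  have := Pdig (Ordinal lt_em); rewrite !ffunE /= posK => ->.
  by rewrite -surjective_pairing.
have [p [[lt_pN cov_p] uniq_p]] := up (map_tuple fst w).
(* From weight [N - p] on, digits come from the next lap; inverting the bijection gives the only lap
   showing the required digits. *)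
have [g fK gK] := digits_carry_bij b m (N - p).
pose k := g [ffun e : 'I_m => (tnth w (pos p e)).2].
have N_gt0 : 0 < N by apply: leq_ltn_trans lt_pN.
exists (p + N * k); split=> [|i [lt_i]].
  rewrite covE // cov_p; split; last by apply/eqP; exact: gK.
  by have := ltn_ord k; nia.
rewrite [i](divn_eq i N) mulnC addnC covE ?ltn_pmod // => /andP[cov_i].
have <- := uniq_p _ (conj (ltn_pmod i N_gt0) cov_i).
have lt_k : i %/ N < b.+1 ^ m by rewrite ltn_divLR // mulnC.
by move=> /eqP eq_dig; rewrite /k -eq_dig (fK (Ordinal lt_k)).
Qed.

(* Found by computer search: a layered flow problem for the windows, grouped by
   the offset of their diamond, followed by an Eulerian tour. *)
Definition binary_upcycle : partial_word bool :=
  flatten [seq None :: map (fun d => Some (d == 1)) v ++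
               None :: map (fun d => Some (d == 0)) v |
    v <- [:: [:: 1; 0; 1; 1; 1; 1; 1];
             [:: 1; 0; 0; 0; 1; 1; 1];
             [:: 0; 0; 0; 0; 1; 1; 1];
             [:: 1; 0; 0; 1; 1; 1; 1];
             [:: 1; 0; 1; 1; 0; 1; 0];
             [:: 0; 0; 0; 1; 0; 1; 0];
             [:: 0; 0; 1; 1; 0; 1; 0];
             [:: 1; 0; 1; 1; 0; 1; 1]]].

(** Explicit lists let [vm_compute] run through all words. *)
Definition binary_words n : seq (seq bool) :=
  iter n (fun ws => map (cons true) ws ++ map (cons false) ws) [:: [::]].

Lemma mem_binary_words n (w : n.-tuple bool) : tval w \in binary_words n.
Proof.
elim: n w => [|n IHn] w; first by rewrite tuple0.
case/tupleP: w => c w /=; rewrite mem_cat.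
by case: c; apply/orP; [left | right]; apply: map_f.
Qed.

Definition covered_once n (xs : seq (partial_word bool)) :=
  all (fun w => count (fun x => covers x w) xs == 1) (binary_words n).

Lemma covered_onceP n (u : partial_word bool) :
  covered_once n [seq window n u i | i <- iota 0 (size u)] -> is_upcycle n u.
Proof.
move=> /allP once; apply/is_upcycleP => w.
have := once _ (mem_binary_words w); rewrite count_map -size_filter.
case Ds: filter => [|i []] // _.
have memE k : (k < size u) && covers (window n u k) w = (k == i).
  by rewrite -[RHS](mem_seq1 k) -Ds mem_filter mem_iota andbC.
by exists i; split=> [|k /andP]; [apply/andP | ]; rewrite memE // => /eqP.
Qed.

Lemma binary_upcycleP : is_upcycle 8 binary_upcycle.
Proof. by apply: covered_onceP; vm_compute. Qed.

Lemma binary_upcycle_diamond i : i < size binary_upcycle ->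
  (nth None binary_upcycle i == None) = (8 %| i).
Proof.
have /allP diamonds : all (fun i => (nth None binary_upcycle i == None) == (8 %| i))
                          (iota 0 (size binary_upcycle)) by vm_compute.
by move=> lt_i; have := diamonds i; rewrite mem_iota => /(_ lt_i)/eqP.
Qed.

Theorem corollary5p3 (a : nat) (a_ge2 : 2 <= a) (a_even : ~~ odd a) :
  exists u : partial_word 'I_a, is_upcycle 8 u /\ nontrivial u.
Proof.
have [b def_a] : exists b, #|{: bool * 'I_b.+1}| = a.
  (* The base [b.+1] is half of [a]. *)
  by exists a./2.-1; rewrite card_prod card_bool card_ord; lia.
pose f (x : bool * 'I_b.+1) : 'I_a := cast_ord def_a (enum_rank x).
have f_bij : bijective f.
  exists (fun i => enum_val (cast_ord (esym def_a) i)) => x.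
    by rewrite /f cast_ordK enum_rankK.
  by rewrite /f enum_valK cast_ordKV.
pose v := upcycle_product b 7 binary_upcycle.
(* Lap 0 suffices for nontriviality: position 0 holds a diamond and position 1 a letter. *)
have mem_v i : i < size binary_upcycle ->
    omap (fun x => f (x, digit b (7 - i %% 8) 0)) (nth None binary_upcycle i)
      \in map (omap f) v.
  move=> lt_i; have lt_iv : i < size binary_upcycle * b.+1 ^ 7.
    by apply: leq_trans lt_i _; rewrite leq_pmulr ?expn_gt0.
  have /(map_f (omap f)) : nth None v i \in v by rewrite mem_nth // size_mkseq.
  by rewrite nth_mkseq // (modn_small lt_i) (divn_small lt_i); case: nth.
exists (map (omap f) v); split.
  apply/(is_upcycle_map f_bij)/is_upcycle_product => //.
    exact: binary_upcycle_diamond.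
  exact: binary_upcycleP.
split; first exact: (mem_v 0).
by exists (f (true, digit b 6 0)); apply: (mem_v 1).
Qed.
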